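(* Let $R$ be a ring. For a left $R$-module $M$ the following conditions are equivalent: (1) $G(M)$ is infinite and $\omega(M)$ is finite; (2) the following conditions hold: (i) $Soc(M)=S\oplus S'$, where $S$ and $S'$ are isomorphic simple modules such that $\mathrm{End}(S)$ is an infinite division ring; (ii) all but finitely many submodules of $M$ are contained in $Soc(M)$.
   Context: Rings are associative with unity and modules are unitary left modules. A nontrivial submodule of $M$ is a submodule different from $0$ and $M$. The intersection graph $G(M)$ is the simple graph whose vertices are the nontrivial submodules of $M$, two distinct vertices being adjacent iff their intersection is nonzero; it is infinite if its vertex set is. A clique is a set of vertices any two distinct members of which are adjacent, and $\omega(M)$ is the clique number of $G(M)$, i.e. the supremum of the cardinalities of its cliques. $Soc(M)$ is the socle of $M$ (sum of all simple submodules), and $\mathrm{End}(S)$ is the ring of $R$-endomorphisms of $S$. *)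

(* Defs.v *)
From HB Require Import structures.
From mathcomp Require Import all_boot all_order all_algebra.
From mathcomp Require Import mathcomp_extra boolp classical_sets functions.
From mathcomp Require Import cardinality.

Set Implicit Arguments.
Unset Strict Implicit.
Unset Printing Implicit Defensive.

Import GRing.Theory.
Local Open Scope ring_scope.
Local Open Scope classical_set_scope.

(* Submodules of [M] are the library's [submodClosed M]: predicates on [M]
   closed under the module operations.  By [submodule_eqP] their Leibniz
   equality is equality of the underlying subsets. *)
Lemma submodule_eqP (R : pzRingType) (M : lmodType R) (N P : submodClosed M) :
  N =i P -> N = P.
Proof.
case: N => N [[a] [b]]; case: P => P [[a'] [b']] NP.
have E : N = P by apply/funext => x; exact: NP.
subst P.
by rewrite (Prop_irrelevance a a') (Prop_irrelevance b b').
Qed.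

Definition submod_type (R : pzRingType) (M : lmodType R)
  (N : submodClosed M) : Type := {x : M | x \in N}.

Section SubmodType.
Variables (R : pzRingType) (M : lmodType R) (N : submodClosed M).
HB.instance Definition _ := SubChoice.on (submod_type N).
HB.instance Definition _ :=
  [SubChoice_isSubLmodule of submod_type N by <:].
End SubmodType.

Definition simple_module (R : pzRingType) (V : lmodType R) : Prop :=
  (exists x : V, x != 0) /\
  forall N : submodClosed V, [set` N] = [set 0] \/ [set` N] = setT.

Definition simple_submodule (R : pzRingType) (M : lmodType R)
  (N : submodClosed M) : Prop := simple_module (submod_type N).

Definition isomorphic_modules (R : pzRingType) (U V : lmodType R) : Prop :=
  exists f : {linear U -> V}, bijective f.

Definition submod_sum (R : pzRingType) (M : lmodType R)
    (F : set (submodClosed M)) : set M :=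
  [set x | exists s : seq M,
     (forall y, y \in s -> exists2 N, F N & y \in N) /\ x = \sum_(y <- s) y].

Definition socle (R : pzRingType) (M : lmodType R) : set M :=
  submod_sum (@simple_submodule R M).
Arguments socle {R} M _.

Definition is_direct_sum (R : pzRingType) (M : lmodType R) (A : set M)
    (N P : submodClosed M) : Prop :=
  A = [set x + y | x in [set` N] & y in [set` P]] /\
  [set` N] `&` [set` P] = [set 0].

(* The ring of endomorphisms of [V]: pointwise addition, and composition
   [f * g := f \o g] as multiplication. *)
Definition endo (R : pzRingType) (V : lmodType R) : Type := {linear V -> V}.

Section EndoRing.
Variables (R : pzRingType) (V : lmodType R).
Implicit Types f g h : endo V.

Lemma endo_eqP f g : f =1 g -> f = g.
Proof.
case: f => f [[a] [b]]; case: g => g [[a'] [b']] fg.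
have E : f = g by apply/funext => x; exact: fg.
subst g.
by rewrite (Prop_irrelevance a a') (Prop_irrelevance b b').
Qed.

HB.instance Definition _ := gen_eqMixin (endo V).
HB.instance Definition _ := gen_choiceMixin (endo V).

Definition endo_zero : endo V := (\0 : V -> V).
Definition endo_opp f : endo V := (\- f).
Definition endo_add f g : endo V := (f \+ g).
Definition endo_one : endo V := idfun.
Definition endo_mul f g : endo V := (f \o g).

Lemma endo_addA : associative endo_add.
Proof. by move=> f g h; apply: endo_eqP => x /=; rewrite addrA. Qed.
Lemma endo_addC : commutative endo_add.
Proof. by move=> f g; apply: endo_eqP => x /=; rewrite addrC. Qed.
Lemma endo_add0 : left_id endo_zero endo_add.
Proof. by move=> f; apply: endo_eqP => x /=; rewrite add0r. Qed.
Lemma endo_addN : left_inverse endo_zero endo_opp endo_add.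
Proof. by move=> f; apply: endo_eqP => x /=; rewrite addNr. Qed.

HB.instance Definition _ :=
  GRing.isZmodule.Build (endo V) endo_addA endo_addC endo_add0 endo_addN.

Lemma endo_mulA : associative endo_mul.
Proof. by move=> f g h; apply: endo_eqP. Qed.
Lemma endo_mul1 : left_id endo_one endo_mul.
Proof. by move=> f; apply: endo_eqP. Qed.
Lemma endo_mulr1 : right_id endo_one endo_mul.
Proof. by move=> f; apply: endo_eqP. Qed.
Lemma endo_mulDl : left_distributive endo_mul +%R.
Proof. by move=> f g h; apply: endo_eqP. Qed.
Lemma endo_mulDr : right_distributive endo_mul +%R.
Proof. by move=> f g h; apply: endo_eqP => x /=; rewrite raddfD. Qed.

HB.instance Definition _ := GRing.Zmodule_isPzRing.Build (endo V)
  endo_mulA endo_mul1 endo_mulr1 endo_mulDl endo_mulDr.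

End EndoRing.

Definition division_ring (D : pzRingType) : Prop :=
  (1 : D) != 0 /\
  forall a : D, a != 0 -> exists b : D, b * a = 1 /\ a * b = 1.

Record sgraph : Type := SGraph {
  vertex :> Type;
  adj : vertex -> vertex -> Prop;
  adj_sym : forall x y, adj x y -> adj y x;
  adj_irrefl : forall x, ~ adj x x }.

Definition infinite_graph (G : sgraph) : Prop := infinite_set [set: G].

Definition clique (G : sgraph) (C : set G) : Prop :=
  forall x y : G, C x -> C y -> x <> y -> adj x y.

(* [n] is the supremum of the cardinalities of the cliques of [G]. *)
Definition clique_number (G : sgraph) (n : nat) : Prop :=
  (forall C : set G, clique C -> (C #<= `I_n)%card) /\
  (forall m : nat, (forall C : set G, clique C -> (C #<= `I_m)%card) -> (n <= m)%N).

Definition finite_clique_number (G : sgraph) : Prop :=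
  exists n, clique_number G n.

Section IntersectionGraph.
Variables (R : pzRingType) (M : lmodType R).

Definition nontrivial_submodule (N : submodClosed M) : Prop :=
  [set` N] <> [set 0] /\ [set` N] <> setT.

Definition igraph_vertex : Type :=
  {N : submodClosed M | nontrivial_submodule N}.

Definition igraph_adj (x y : igraph_vertex) : Prop :=
  x <> y /\ [set` sval x] `&` [set` sval y] <> [set 0].

Lemma igraph_adj_sym x y : igraph_adj x y -> igraph_adj y x.
Proof. by case=> xy I; split; [exact: nesym | rewrite setIC]. Qed.

Lemma igraph_adj_irrefl x : ~ igraph_adj x x.
Proof. by case. Qed.

Definition intersection_graph : sgraph :=
  SGraph igraph_adj_sym igraph_adj_irrefl.

End IntersectionGraph.

(* Main.v *)
(* If cliques are finite, then every nonzero submodule contains a simple one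
   and has only finitely many submodules above it. An infinite graph thus
   has infinitely many simple submodules, and for a fixed simple [S] the
   sums [S + T] take finitely many values, so some [W = S + S'] contains
   infinitely many simple submodules. All but [S] and [S'] are graphs of
   isomorphisms [S -> S'], whence [End(S)] is infinite, and [W] is the whole
   socle. The submodules outside [W] with a given sum with [W] meet
   pairwise, hence are finitely many. Conversely, two distinct nonzero
   proper submodules of [S + S'] meet trivially, so a clique has at most one
   vertex that is neither [S + S'] nor one of the finitely many submodules
   outside [S + S']; the graphs of the homomorphisms [S -> S'] are
   infinitely many vertices. *)
Require Import Defs.
From HB Require Import structures.
From mathcomp Require Import all_boot all_order all_algebra.
From mathcomp Require Import mathcomp_extra boolp classical_sets functions.
From mathcomp Require Import cardinality.

Set Implicit Arguments.
Unset Strict Implicit.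
Unset Printing Implicit Defensive.

Import GRing.Theory.
Local Open Scope ring_scope.
Local Open Scope classical_set_scope.

(** * Finiteness through images and fibres *)

Lemma finite_fibers (T U : Type) (f : T -> U) (A : set T) :
  finite_set (f @` A) -> (forall y, finite_set [set x | A x /\ f x = y]) ->
  finite_set A.
Proof.
move=> fA fib; apply: sub_finite_set (bigcup_finite fA (fun y _ => fib y)).
by move=> x Ax; exists (f x); [exists x | split].
Qed.

Lemma finite_injective_image (T U : Type) (f : T -> U) (A : set T) :
  (forall x y, A x -> A y -> f x = f y -> x = y) -> finite_set (f @` A) ->
  finite_set A.
Proof.
move=> inj /finite_fibers; apply=> y.
have [[x [Ax fx]]|no] := pselect (exists x, A x /\ f x = y).
  apply: sub_finite_set (finite_set1 x) => z [Az fz].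
  by apply: inj => //; rewrite fx.
by apply: sub_finite_set (@finite_set0 T) => z [Az fz]; apply: no; exists z.
Qed.

(** * Zero, full, sum and intersection submodules *)

Section Submodules.
Variables (R : pzRingType) (M : lmodType R).
Implicit Types (N P Q S T : submodClosed M) (A : set M).

Section OfSet.
Variable A : set M.
Hypotheses (A0 : A 0) (AL : forall a x y, A x -> A y -> A (a *: x + y)).

(** The closure proofs are arguments so that the [submodClosed] structure can be attached to the
    predicate itself. *)
Definition submod_pred of A 0 & (forall a x y, A x -> A y -> A (a *: x + y))
  : {pred M} := fun x => `[< A x >].

Fact submod_pred_closed : GRing.submod_closed (submod_pred A0 AL).
Proof.
split; first exact/asboolP.
by move=> a x y /asboolP Ax /asboolP Ay; apply/asboolP; exact: AL.
Qed.

HB.instance Definition _ :=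
  GRing.isSubmodClosed.Build R M (submod_pred A0 AL) submod_pred_closed.

Definition submod_of : submodClosed M := submod_pred A0 AL.

Arguments submod_of : simpl never.

Lemma in_submod_of x : x \in submod_of <-> A x.
Proof. by split=> [/asboolP|Ax] //; apply/asboolP. Qed.
End OfSet.

Lemma submodN N x : x \in N -> - x \in N.
Proof. by move=> xN; rewrite -scaleN1r rpredZ. Qed.

Lemma submodB N x y : x \in N -> y \in N -> x - y \in N.
Proof. by move=> xN yN; rewrite rpredD // submodN. Qed.

Lemma submod_eq N P : {subset N <= P} -> {subset P <= N} -> N = P.
Proof.
by move=> NP PN; apply: submodule_eqP => x; apply/idP/idP => [/NP|/PN].
Qed.

Fact submod_bot_lin (a : R) (x y : M) : x = 0 -> y = 0 -> a *: x + y = 0.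
Proof. by move=> -> ->; rewrite scaler0 addr0. Qed.
Definition submod_bot : submodClosed M :=
  submod_of (A := [set 0]) (erefl _) submod_bot_lin.
Definition submod_top : submodClosed M :=
  submod_of (A := setT) I (fun _ _ _ _ _ => I).

Definition submod_addset N P : set M :=
  [set z | exists x y, [/\ x \in N, y \in P & z = x + y]].
Fact submod_addset0 N P : submod_addset N P 0.
Proof. by exists 0, 0; rewrite !rpred0 addr0. Qed.
Fact submod_addset_lin N P a x y :
  submod_addset N P x -> submod_addset N P y -> submod_addset N P (a *: x + y).
Proof.
move=> [u [v [uN vP ->]]] [u' [v' [uN' vP' ->]]].
exists (a *: u + u'), (a *: v + v'); split; try by rewrite rpredD // rpredZ.
by rewrite scalerDr addrACA.
Qed.
Definition addsm N P : submodClosed M :=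
  submod_of (submod_addset0 N P) (@submod_addset_lin N P).

Arguments addsm : simpl never.

Lemma addsmP N P z :
  z \in addsm N P <-> exists x y, [/\ x \in N, y \in P & z = x + y].
Proof. exact: in_submod_of. Qed.

Lemma addsml N P : {subset N <= addsm N P}.
Proof. by move=> x xN; apply/addsmP; exists x, 0; rewrite rpred0 addr0. Qed.

Lemma addsmr N P : {subset P <= addsm N P}.
Proof. by move=> x xP; apply/addsmP; exists 0, x; rewrite rpred0 add0r. Qed.

Lemma addsm_sub N P Q :
  {subset N <= Q} -> {subset P <= Q} -> {subset addsm N P <= Q}.
Proof.
by move=> NQ PQ _ /addsmP[x [y [/NQ xQ /PQ yQ ->]]]; exact: rpredD.
Qed.

Lemma submod_capL N P a x y :
  x \in N /\ x \in P -> y \in N /\ y \in P ->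
  a *: x + y \in N /\ a *: x + y \in P.
Proof. by move=> [? ?] [? ?]; split; rewrite rpredD // rpredZ. Qed.
Definition capsm N P : submodClosed M :=
  submod_of (A := [set x | x \in N /\ x \in P])
    (conj (rpred0 N) (rpred0 P)) (@submod_capL N P).

Arguments capsm : simpl never.

Lemma capsmP N P x : x \in capsm N P <-> x \in N /\ x \in P.
Proof. exact: in_submod_of. Qed.

Definition nonzero N := exists2 x, x \in N & x != 0.
Definition meets N P := exists x, [/\ x \in N, x \in P & x != 0].

Lemma meetsC N P : meets N P -> meets P N.
Proof. by case=> x []; exists x. Qed.

Lemma not_meets N P x : ~ meets N P -> x \in N -> x \in P -> x = 0.
Proof.
by move=> no xN xP; apply/eqP; apply/negPn/negP => x0; apply: no; exists x.
Qed.

Lemma setI_neq0 N P : [set` N] `&` [set` P] <> [set 0] <-> meets N P.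
Proof.
split=> [ne|[x [xN xP /eqP x0]] E].
  apply: contrapT => no; apply: ne; apply/seteqP; split=> x /=.
    by case=> xN xP; exact: not_meets no xN xP.
  by move=> ->; rewrite !rpred0.
by apply: x0; rewrite -[x = 0]/([set 0] x) -E.
Qed.

Lemma set_neq0 N : [set` N] <> [set 0] <-> nonzero N.
Proof.
rewrite -[[set` N]]setIid setI_neq0.
by split=> [[x []]|[x]]; exists x.
Qed.

Lemma set_eq0 N : [set` N] = [set 0] <-> ~ nonzero N.
Proof. by rewrite -set_neq0; split=> [-> //|]; exact: contrapT. Qed.

(** Simplicity as being an atom of the lattice of submodules of [M], which avoids passing to
    [submod_type S]. *)
Definition simplesm S :=
  nonzero S /\ forall P, {subset P <= S} -> nonzero P -> {subset S <= P}.


End Submodules.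

(** * Simple submodules and the sum of two of them *)

Section Simple.
Variables (R : pzRingType) (M : lmodType R).
Implicit Types (N P Q S T : submodClosed M).

Lemma val_lin S a (x y : submod_type S) : val (a *: x + y) = a *: val x + val y.
Proof. by []. Qed.

Lemma val_zero S : val (0 : submod_type S) = 0.
Proof. by []. Qed.

Lemma preim0 S P : val (0 : submod_type S) \in P.
Proof. by rewrite val_zero rpred0. Qed.
Lemma preim_lin S P a (x y : submod_type S) :
  val x \in P -> val y \in P -> val (a *: x + y) \in P.
Proof. by move=> xP yP; rewrite val_lin rpredD // rpredZ. Qed.
Definition preimsm S P : submodClosed (submod_type S) :=
  submod_of (A := [set x | val x \in P]) (preim0 S P) (@preim_lin S P).

Lemma im_lin S (Q : submodClosed (submod_type S)) a (x y : M) :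
  (exists2 u, u \in Q & val u = x) -> (exists2 u, u \in Q & val u = y) ->
  exists2 u, u \in Q & val u = a *: x + y.
Proof.
move=> [u uQ <-] [v vQ <-]; exists (a *: u + v) => //.
by rewrite rpredD // rpredZ.
Qed.
Definition imsm S (Q : submodClosed (submod_type S)) : submodClosed M :=
  submod_of (A := [set x | exists2 u, u \in Q & val u = x])
    (ex_intro2 _ _ 0 (rpred0 Q) (val_zero S)) (@im_lin S Q).

(** [preimsm] and [imsm] carry submodules between [M] and [submod_type S]. *)
Lemma simple_submoduleP S : simple_submodule S <-> simplesm S.
Proof.
split=> [[[x x0] simp]|[[x xS x0] simp]].
  split; first by exists (val x); [exact: valP | ].
  move=> P PS [y yP y0] z zS.
  have [E|E] := simp (preimsm S P).
    have : [set` preimsm S P] (Sub y (PS y yP)) by apply/in_submod_of.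
    by rewrite E /= => /(congr1 val) /= y0'; rewrite y0' eqxx in y0.
  have : [set` preimsm S P] (Sub z zS) by rewrite E.
  by move/in_submod_of.
split; first by exists (Sub x xS).
move=> N; have [nN|nN] := pselect (nonzero N); last by left; apply/set_eq0.
right; apply/seteqP; split=> // u _ /=.
have /simp/(_ _)/(_ (val u) (valP u)) : {subset imsm N <= S}.
  by move=> y /in_submod_of[v vN <-]; exact: valP.
case/(_ _)/in_submod_of; last by move=> v vN /val_inj <-.
by case: nN => v vN v0; exists (val v) => //; apply/in_submod_of; exists v.
Qed.

Lemma simple_sub S N : simplesm S -> meets S N -> {subset S <= N}.
Proof.
move=> [_ simp] [x [xS xN x0]] y yS.
have : y \in capsm S N.
  apply: simp => //; first by move=> z /capsmP[].
  by exists x => //; apply/capsmP.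
by case/capsmP.
Qed.

Lemma simple_eq S T : simplesm S -> simplesm T -> meets S T -> S = T.
Proof.
by move=> sS sT m; apply: submod_eq; apply: simple_sub => //; exact: meetsC.
Qed.

(** [P] embeds in the quotient of [addsm S S'] by [S'], which is a quotient of the simple [S]; so a
    nonzero [N] inside [P] is all of it. *)
Lemma sub_of_complement S S' N P : simplesm S -> {subset N <= P} ->
  nonzero N -> {subset P <= addsm S S'} -> ~ meets P S' -> {subset P <= N}.
Proof.
move=> sS NP [n nN n0] PW PS'.
have [s [s' [sS1 s'S ns]]] : exists s s', [/\ s \in S, s' \in S' & n = s + s'].
  exact/addsmP/PW/NP.
have sS' : {subset S <= addsm N S'}.
  apply: simple_sub => //; exists s; split=> //.
    apply/addsmP; exists n, (- s').
    by split; [|exact: submodN|rewrite ns addrK].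
  apply/eqP => s0; apply: PS'; exists n; split=> //; first exact: NP.
  by rewrite ns s0 add0r.
move=> p pP.
have /addsmP[u [u' [/sS'/addsmP[m [m' [mN m'S ->]]] u'S pE]]] := PW p pP.
have : p - m = 0.
  apply: (not_meets PS'); first by rewrite submodB // NP.
  by rewrite pE addrC !addrA addNr add0r rpredD.
by move/eqP; rewrite subr_eq0 => /eqP ->.
Qed.

(** If [P] meets both [S] and [S'], it contains both by simplicity; otherwise [sub_of_complement]
    applies to the one it does not meet. *)
Lemma addsm_simple_sub S S' N P : simplesm S -> simplesm S' ->
    {subset N <= P} -> nonzero N -> {subset P <= addsm S S'} ->
  {subset P <= N} \/ {subset addsm S S' <= P}.
Proof.
move=> sS sS' NP nN PW.
have [mS'|] := pselect (meets P S'); last first.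
  by left; exact: sub_of_complement PW _.
have PW' : {subset P <= addsm S' S}.
  move=> p /PW/addsmP[x [y [? ? ->]]].
  by apply/addsmP; exists y, x; rewrite addrC.
have [mS|] := pselect (meets P S); last first.
  by left; exact: sub_of_complement PW' _.
by right; apply: addsm_sub; apply: simple_sub => //; exact: meetsC.
Qed.

(** Apply [addsm_simple_sub] to [T] inside [addsm T T']: the other alternative would put [T'] inside
    [T], hence make them equal. *)
Lemma addsm_two_simple S S' T T' : simplesm S -> simplesm S' ->
    simplesm T -> simplesm T' -> T <> T' ->
    {subset T <= addsm S S'} -> {subset T' <= addsm S S'} ->
  {subset addsm S S' <= addsm T T'}.
Proof.
move=> sS sS' sT sT' TT' TW TW'.
have [|sub|//] :=
  addsm_simple_sub sS sS' (@addsml _ _ T T') _ (addsm_sub TW TW').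
  by case: sT.
case: TT'; apply: simple_eq => //; case: (sT').1 => x xT x0.
by exists x; split=> //; apply/sub/addsmr.
Qed.

(** The nonzero [capsm N P] fills both [N] and [P] by [addsm_simple_sub], since neither is the whole
    sum. *)
Lemma meet_in_addsm S S' N P : simplesm S -> simplesm S' ->
    {subset N <= addsm S S'} -> {subset P <= addsm S S'} -> meets N P ->
    N <> addsm S S' -> P <> addsm S S' -> N = P.
Proof.
move=> sS sS' NW PW [x [xN xP x0]] Nn Pn.
have nQ : nonzero (capsm N P) by exists x => //; apply/capsmP.
have QN : {subset capsm N P <= N} by move=> y /capsmP[].
have QP : {subset capsm N P <= P} by move=> y /capsmP[].
have [sN|WN] := addsm_simple_sub sS sS' QN nQ NW; last first.
  by case: Nn; exact: submod_eq.
have [sP|WP] := addsm_simple_sub sS sS' QP nQ PW; last first.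
  by case: Pn; exact: submod_eq.
by apply: submod_eq => y => [/sN|/sP]; [exact: QP|exact: QN].
Qed.

Section Graph.
Variables (S S' T : submodClosed M).
Hypotheses (TS' : ~ meets T S') (ST : {subset S <= addsm T S'}).

(** [ST] gives every [x] in [S] a value and [TS'] makes it unique; linearity follows from
    uniqueness. *)
Lemma graph_hom : exists f : {linear submod_type S -> submod_type S'},
  forall x : submod_type S, val x + val (f x) \in T.
Proof.
have ex (x : submod_type S) : {y : submod_type S' | val x + val y \in T}.
  (* The value is the negated [S']-component of [x], so that adding it to [x] leaves the component
     in [T]. *)
  apply: cid; have /addsmP[t [s [tT sS xE]]] := ST (valP x).
  by exists (Sub (- s) (submodN sS)); rewrite /= xE addrK.
have uniq (x : submod_type S) (y y' : submod_type S') :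
  val x + val y \in T -> val x + val y' \in T -> y = y'.
  move=> yT y'T; apply/val_inj/eqP; rewrite -subr_eq0; apply/eqP.
  apply: (not_meets TS'); last by rewrite submodB //; exact: valP.
  by have := submodB yT y'T; rewrite opprD addrACA subrr add0r.
pose f x := sval (ex x).
have fP x : val x + val (f x) \in T by exact: svalP (ex x).
have fL : linear f.
  move=> a x y; apply: (uniq _ _ _ (fP _)).
  rewrite !val_lin addrACA -scalerDr.
  by rewrite rpredD // rpredZ.
pose Lf := GRing.isLinear.Build R _ _ _ f fL.
pose F : {linear submod_type S -> submod_type S'} := HB.pack f Lf.
by exists F.
Qed.
End Graph.

(** [T] meets neither [S] nor [S'], and its sum with either one is the whole of [addsm S S']; so [T]
    is a graph in both directions, of mutually inverse maps. *)
Lemma simple_isom S S' T : simplesm S -> simplesm S' -> simplesm T ->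
    S <> S' -> T <> S -> T <> S' -> {subset T <= addsm S S'} ->
  exists (f : {linear submod_type S -> submod_type S'})
    (g : {linear submod_type S' -> submod_type S}),
  [/\ cancel f g, cancel g f &
      forall x : submod_type S, val x + val (f x) \in T].
Proof.
move=> sS sS' sT SS' TS TS' TW.
have nTS : ~ meets T S by move=> /simple_eq; auto.
have nTS' : ~ meets T S' by move=> /simple_eq; auto.
have W := @addsm_two_simple S S' _ _ sS sS' sT.
have [f fP] : exists f : {linear submod_type S -> submod_type S'},
    forall x : submod_type S, val x + val (f x) \in T.
  apply: graph_hom nTS' _ => x xS; apply: W => //; first exact: addsmr.
  exact: addsml.
have [g gP] : exists f : {linear submod_type S' -> submod_type S},
    forall x : submod_type S', val x + val (f x) \in T.
  apply: graph_hom nTS _ => x xS; apply: W => //; first exact: addsml.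
  exact: addsmr.
(* [f x + g (f x)] and [x + f x] are both in [T]; their difference [g (f x) - x] is also in [S],
   hence zero. The other composite is symmetric. *)
exists f, g; split=> // x; apply/val_inj/eqP; rewrite -subr_eq0; apply/eqP.
  apply: (not_meets nTS); last by rewrite submodB //; exact: valP.
  have := submodB (gP (f x)) (fP x).
  by rewrite [val x + _]addrC opprD addrACA subrr add0r.
apply: (not_meets nTS'); last by rewrite submodB //; exact: valP.
have := submodB (fP (g x)) (gP x).
by rewrite [val x + _]addrC opprD addrACA subrr add0r.
Qed.
End Simple.

(** * Schur's lemma *)

Section Schur.
Variables (R : pzRingType) (V : lmodType R).

(** For nonzero [a], the kernel is not everything and the image is not zero, so simplicity makes [a]
    bijective. *)
Lemma schur : simple_module V -> division_ring (endo V).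
Proof.
move=> [[v v0] simp]; split.
  by apply: contra_neq v0 => /(congr1 (fun f : endo V => f v)).
move=> a a0.
have kerL c x y : a x = 0 -> a y = 0 -> a (c *: x + y) = 0.
  by move=> ax ay; rewrite linearP ax ay scaler0 addr0.
have imL c x y : (exists u, a u = x) -> (exists u, a u = y) ->
    exists u, a u = c *: x + y.
  by move=> [u <-] [w <-]; exists (c *: u + w); rewrite linearP.
pose K := submod_of (A := [set x | a x = 0]) (raddf0 a) kerL.
pose I := submod_of (A := [set x | exists u, a u = x])
  (ex_intro _ 0 (raddf0 a)) imL.
have inK x : x \in K <-> a x = 0 by exact: in_submod_of.
have inI x : x \in I <-> exists u, a u = x by exact: in_submod_of.
have [w aw] : exists w, a w != 0.
  apply: contrapT => no; move/eqP: a0; apply; apply: endo_eqP => x.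
  by apply/eqP/negPn/negP => ax; apply: no; exists x.
have a_inj : injective a.
  have [K0|KV] := simp K; last first.
    move: aw; rewrite (_ : a w = 0) ?eqxx //; apply/inK.
    by have : [set` K] w by rewrite KV.
  move=> x y axy; apply/eqP; rewrite -subr_eq0; apply/eqP.
  rewrite -[_ = 0]/([set 0] (x - y)) -K0 /=; apply/inK.
  by rewrite (raddfB a x y : a (x - y) = a x - a y) axy subrr.
have ex y : {x | a x = y}.
  apply: cid; apply/inI; have [I0|IV] := simp I.
    have : [set` I] (a w) by apply/inI; exists w.
    by rewrite I0 /= => aw0; rewrite aw0 eqxx in aw.
  by have : [set` I] y by rewrite IV.
pose b y := sval (ex y).
have bK y : a (b y) = y by exact: svalP (ex y).
(* Linearity of the inverse is checked after applying the injective [a]. *)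
have bL : linear b by move=> c x y; apply: a_inj; rewrite linearP !bK.
pose Lb := GRing.isLinear.Build R _ _ _ b bL.
pose B : {linear V -> V} := HB.pack b Lb.
exists (B : endo V); split; apply: endo_eqP => x; last exact: bK.
by apply: a_inj; exact: bK.
Qed.
End Schur.

(** * Consequences of the finiteness of all cliques *)

Section FiniteCliques.
Variables (R : pzRingType) (M : lmodType R).
Implicit Types (N P Q S T : submodClosed M).
Hypothesis fin_clique :
  forall C : set (intersection_graph M), clique C -> finite_set C.

Lemma sval_vertex_inj (x y : intersection_graph M) : sval x = sval y -> x = y.
Proof.
case: x y => [N nN] [P nP] /= NP; rewrite {N}NP in nN *.
by rewrite (Prop_irrelevance nN nP).
Qed.

(** The members of [F] that are vertices form a clique; only the zero and the full submodule can be
    left over. All later uses of the clique hypothesis go through this form. *)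
Lemma finite_meeting (F : set (submodClosed M)) :
  (forall N P, F N -> F P -> N <> P -> meets N P) -> finite_set F.
Proof.
move=> mF; pose C : set (intersection_graph M) := [set x | F (sval x)].
have finC : finite_set C.
  apply: fin_clique => x y Fx Fy xy; split=> //; apply/setI_neq0/mF => //.
  by move/sval_vertex_inj.
apply: (@sub_finite_set _ _
  ((sval : igraph_vertex M -> _) @` C `|` [set submod_bot M; submod_top M])).
  move=> N FN; have [nN|zN] := pselect (nonzero N); last first.
    right; left; apply: submod_eq => x.
      move=> xN; apply/in_submod_of.
      by apply/eqP/negPn/negP => x0; apply: zN; exists x.
    by move/in_submod_of => ->; rewrite rpred0.
  have [NT|NT] := pselect ([set` N] = setT); last first.
    by left; exists (exist _ N (conj ((set_neq0 N).2 nN) NT)).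
  right; right; apply: submod_eq => x _; first exact/in_submod_of.
  by have : [set` N] x by rewrite NT.
rewrite finite_setU; split; first exact: finite_image.
exact: finite_set2.
Qed.

Lemma finite_above N : nonzero N ->
  finite_set [set P : submodClosed M | {subset N <= P}].
Proof.
by case=> x xN x0; apply: finite_meeting => P Q NP NQ _; exists x; split; auto.
Qed.

(** Otherwise dependent choice yields a strictly descending sequence of nonzero submodules, any two
    of which meet in the smaller one. *)
Lemma simple_below N : nonzero N -> exists2 T, simplesm T & {subset T <= N}.
Proof.
move=> nN; apply: contrapT => no.
pose X := {P : submodClosed M | nonzero P /\ {subset P <= N}}.
pose sub (P Q : submodClosed M) := {subset P <= Q}.
have next (P : X) :
    {Q : X | sub (sval Q) (sval P) /\ ~ sub (sval P) (sval Q)}.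
  apply: cid; apply: contrapT => noQ; case: P noQ => P [nP PN] /= noQ.
  apply: no; exists P => //; split=> // Q QP nQ; apply: contrapT => PQ.
  apply: noQ; have QN : {subset Q <= N} by move=> x /QP/PN.
  by exists (exist _ Q (conj nQ QN)).
have [f [_ fS]] := dependent_choice next (exist _ N (conj nN (fun _ => id))).
pose g n : submodClosed M := sval (f n).
have gle m n : (m <= n)%N -> {subset g n <= g m}.
  move=> /subnK <-; elim: (n - m)%N => [//|k IH] x.
  by rewrite addSn => /(fS _).1/IH.
have glt m n : (m < n)%N -> g m <> g n.
  by move=> mn E; apply: (fS m).2 => x; rewrite -/(g m) E; exact: gle.
(* The strict descent makes [g] injective on the natural numbers, while [finite_meeting] makes its
   range finite. *)
apply: infinite_nat; apply: (@finite_injective_image _ _ g).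
  move=> m n _ _ gmn; have [mn|nm|//] := ltngtP m n.
    by case: (glt _ _ mn).
  by case: (glt _ _ nm).
apply: finite_meeting => _ _ [m _ <-] [n _ <-] _.
have [x xg x0] : nonzero (g (maxn m n)) by case: (svalP (f (maxn m n))).
by exists x; split=> //; apply: gle xg; rewrite ?leq_maxl ?leq_maxr.
Qed.

Lemma infinite_simples : infinite_graph (intersection_graph M) ->
  infinite_set [set T | @simplesm R M T].
Proof.
move=> infG finS; apply: infG; apply: (@finite_injective_image _ _ sval).
  by move=> x y _ _ /sval_vertex_inj.
apply: (@sub_finite_set _ _
  (\bigcup_(T in [set T | @simplesm R M T])
     [set P : submodClosed M | {subset T <= P}])).
  move=> _ [[N [N0 NT]] _ <-]; have [|T sT TN] := @simple_below N.
    exact/set_neq0.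
  by exists T.
by apply: bigcup_finite => // T [nT _]; exact: finite_above.
Qed.

(** For a fixed simple [S], the map sending [T] to [addsm S T] has finite image, as its values lie
    above [S]; so some fibre is infinite. *)
Lemma infinite_simples_pair : infinite_graph (intersection_graph M) ->
  exists S S', [/\ simplesm S, simplesm S', S <> S' &
    infinite_set [set T | simplesm T /\ {subset T <= addsm S S'}]].
Proof.
move=> /infinite_simples infS; apply: contrapT => no.
have [S sS] : exists S, simplesm S.
  apply: contrapT => noS; apply: infS.
  apply: sub_finite_set (@finite_set0 _) => S sS.
  by apply: noS; exists S.
apply: infS; apply: (@finite_fibers _ _ (addsm S)).
  apply: sub_finite_set (finite_above sS.1) => _ [T _ <-]; exact: addsml.
move=> W; have [[S' [sS' SS' E]]|noS'] :=
  pselect (exists S', [/\ simplesm S', S <> S' & addsm S S' = W]).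
  apply: contrapT => inf; apply: no; exists S, S'; split=> // fin; apply: inf.
  apply: sub_finite_set fin => T [sT WT]; split=> //.
  by rewrite E -WT; exact: addsmr.
(* A value not of the form [addsm S S'] with [S'] simple and distinct from [S] can only come from
   [S] itself. *)
apply: sub_finite_set (finite_set1 S) => T [sT WT]; apply: contrapT => TS.
by apply: noS'; exists T; split=> // /esym.
Qed.

(** * A sum of two simple submodules containing infinitely many simple ones *)

Section Pair.
Variables S S' : submodClosed M.
Hypotheses (sS : simplesm S) (sS' : simplesm S') (SS' : S <> S').
Let W := addsm S S'.
Hypothesis infW : infinite_set [set T | simplesm T /\ {subset T <= W}].

(* If a simple [U] is not in [W], then [T |-> U + T] embeds the infinitely many
   simple submodules [T] of [W] in the finite set of submodules above [U]. *)
Lemma simple_in_pair U : simplesm U -> {subset U <= W}.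
Proof.
move=> sU; apply: contrapT => UW.
have nUW : ~ meets W U by move=> /meetsC/(simple_sub sU).
apply: infW; apply: (@finite_injective_image _ _ (addsm U)); last first.
  by apply: sub_finite_set (finite_above sU.1) => _ [T _ <-]; exact: addsml.
move=> T T' [sT TW] [sT' T'W] E; apply: simple_eq => //.
case: (sT.1) => t tT t0; exists t; split=> //.
have : t \in addsm U T' by rewrite -E; exact: addsmr.
move=> /addsmP[u [t' [uU t'T' tE]]].
have u0 : u = 0.
  apply: (not_meets nUW) => //.
  by rewrite -(addrK t' u) -tE submodB //; [exact: TW|exact: T'W].
by rewrite tE u0 add0r.
Qed.

Lemma socle_pair : socle M = [set` W].
Proof.
apply/seteqP; split=> x.
  move=> [s [sP ->]] /=; rewrite big_seq; apply: rpred_sum => y /sP[N].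
  by move=> /simple_submoduleP/simple_in_pair NW /NW.
move=> /addsmP[y [z [yS zS ->]]]; exists [:: y; z]; split; last first.
  by rewrite !big_cons big_nil addr0.
move=> t; rewrite !inE => /orP[] /eqP ->.
  by exists S => //; exact/simple_submoduleP.
by exists S' => //; exact/simple_submoduleP.
Qed.

(* If [N + W = N' + W] and [N], [N'] meet trivially, with simple submodules [T]
   and [T'] respectively, then [W = T + T'], so [N'] is a submodule of
   [N + T'], which forces [N' = T'] to be in [W]. *)
Lemma meets_outside_pair N N' : ~ {subset N <= W} -> ~ {subset N' <= W} ->
  addsm N W = addsm N' W -> meets N N'.
Proof.
have nz P : ~ {subset P <= W} -> nonzero P.
  move=> PW; apply: contrapT => zP; apply: PW => x xP.
  by have [->|x0] := eqVneq x 0; [exact: rpred0|case: zP; exists x].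
move=> NW N'W E; apply: contrapT => noN.
have [T sT TN] := simple_below (nz _ NW).
have [T' sT' T'N] := simple_below (nz _ N'W).
have TT' : T <> T'.
  move=> TT'; case: (sT.1) => x xT x0; apply: noN; exists x; split; auto.
  by apply: T'N; rewrite -TT'.
have TW := simple_in_pair sT; have T'W := simple_in_pair sT'.
have W2 := addsm_two_simple sS sS' sT sT' TT' TW T'W.
apply: N'W => x xN'; have : x \in addsm N W by rewrite E; exact: addsml.
move=> /addsmP[n [_ [nN /W2/addsmP[t [t' [tT t'T' ->]]] xE]]].
have : x - t' = 0.
  apply: (not_meets noN); last by rewrite submodB //; exact: T'N.
  by rewrite xE addrA addrK rpredD //; exact: TN.
by move/eqP; rewrite subr_eq0 => /eqP ->; exact: T'W.
Qed.

(** Sums with [W] lie above [W], so they take finitely many values, and [meets_outside_pair] makes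
    each fibre pairwise meeting. *)
Lemma finite_outside_pair :
  finite_set [set N : submodClosed M | ~ {subset N <= W}].
Proof.
apply: (@finite_fibers _ _ (fun N => addsm N W)).
  have nW : nonzero W by case: sS.1 => x xS; exists x => //; exact: addsml.
  by apply: sub_finite_set (finite_above nW) => _ [N _ <-]; exact: addsmr.
move=> L; apply: finite_meeting => N P [NW NL] [PW PL] _.
by apply: meets_outside_pair => //; rewrite NL.
Qed.

(** An infinite family contains a simple [T] other than [S] and [S'], which is the graph of an
    isomorphism. *)
Lemma isom_pair : exists (f : {linear submod_type S -> submod_type S'})
    (g : {linear submod_type S' -> submod_type S}), cancel f g /\ cancel g f.
Proof.
have [T [[sT TW] TS TS']] : exists T,
    [/\ simplesm T /\ {subset T <= W}, T <> S & T <> S'].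
  apply: contrapT => no; apply: infW.
  apply: sub_finite_set (finite_set2 S S') => T TP.
  apply: contrapT => /not_orP[TS TS'].
  by apply: no; exists T.
have [f [g [fK gK _]]] := simple_isom sS sS' sT SS' TS TS' TW.
by exists f, g.
Qed.

(** Each simple [T] in [W] other than [S] and [S'] is the graph of a map [f]; composing [f] with one
    fixed isomorphism [g] from [S'] back to [S] gives an endomorphism that determines [T]. *)
Lemma infinite_endo_pair : infinite_set [set: endo (submod_type S)].
Proof.
have [f0 [g [fK gK]]] := isom_pair.
have ex T : exists h : endo (submod_type S),
    (simplesm T /\ {subset T <= W}) /\ T <> S /\ T <> S' ->
    forall x : submod_type S, val x + val (f0 (h x)) \in T.
  have [[[sT TW] [TS TS']]|no] := pselect
      ((simplesm T /\ {subset T <= W}) /\ T <> S /\ T <> S'); last first.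
    (* Default value for the submodules outside the family. *)
    by exists 0.
  have [f [_ [_ _ fP]]] := simple_isom sS sS' sT SS' TS TS' TW.
  exists (g \o f : {linear submod_type S -> submod_type S}) => _ x.
  by rewrite /= gK; exact: fP.
have {ex} [h hP] := choice ex.
move=> finE; apply: infW.
apply: (@sub_finite_set _ _
  ([set T | (simplesm T /\ {subset T <= W}) /\ T <> S /\ T <> S']
     `|` [set S; S'])).
  move=> T TP; have [?|nT] := pselect (T = S \/ T = S'); [by right|left].
  by split=> //; split=> E; apply: nT; [left|right].
rewrite finite_setU; split; last exact: finite_set2.
apply: (@finite_injective_image _ _ h); last exact: sub_finite_set finE.
move=> T T' TP T'P E; case: (TP) (T'P) => [[sT _] _] [[sT' _] _].
apply: simple_eq => //; case: (sS.1) => x xS x0.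
pose u : submod_type S := Sub x xS.
exists (val u + val (f0 (h T u))); split; [exact: hP|by rewrite E; exact: hP|].
(* If this common element of [T] and [T'] were zero, the nonzero [x] would lie in both [S] and
   [S']. *)
apply/eqP => u0; apply: SS'; apply: simple_eq => //; exists x; split=> //.
have -> : x = - val (f0 (h T u)) 
  by apply/eqP; rewrite -addr_eq0; apply/eqP.
by apply: submodN; exact: valP.
Qed.
End Pair.
End FiniteCliques.

(** * From a sum of two simple submodules back to the graph *)

Lemma finite_clique_number_bound (G : sgraph) (n : nat) :
  (forall C : set G, clique C -> (C #<= `I_n)%card) -> finite_clique_number G.
Proof.
move=> bn; pose B m := `[< forall C : set G, clique C -> (C #<= `I_m)%card >].
have exB : exists m, B m by exists n; exact/asboolP.
case: (ex_minnP exB) => m /asboolP Bm mB; exists m; split=> // k /asboolP.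
exact: mB.
Qed.

Section SumOfTwoSimples.
Variables (R : pzRingType) (M : lmodType R) (S S' : submodClosed M).
Hypotheses (sS : simplesm S) (sS' : simplesm S').
Let W := addsm S S'.

(** Colour the finitely many vertices in [F] by distinct numbers below [m], and all those properly
    inside [W] by [m]. By [meet_in_addsm] a clique has at most one vertex of colour [m], so [m.+1]
    bounds its size. *)
Lemma finite_clique_number_pair :
  finite_set [set N : submodClosed M | ~ {subset N <= W}] ->
  finite_clique_number (intersection_graph M).
Proof.
pose F := [set N : submodClosed M | ~ {subset N <= W}] `|` [set W].
move=> finF; have {finF} : finite_set F by rewrite finite_setU; split.
move=> /finite_set_leP[m /pcard_leP[e]].
have em N : F N -> (e N < m)%N by exact: (@funS _ _ F `I_m e).
pose c (x : igraph_vertex M) := if pselect (F (sval x)) then e (sval x) else m.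
apply: (@finite_clique_number_bound _ m.+1) => C cC.
have c_inj : {in C &, injective c}.
  move=> x y /set_mem Cx /set_mem Cy; rewrite /c.
  case: pselect => Fx; case: pselect => Fy /=.
  - by move=> exy; apply: sval_vertex_inj; apply: (@inj _ _ F e); rewrite ?inE.
  - by move=> exm; have := em _ Fx; rewrite exm ltnn.
  - by move=> eym; have := em _ Fy; rewrite -eym ltnn.
  move=> _; apply: contrapT => xy; have [_ /setI_neq0 mxy] := cC _ _ Cx Cy xy.
  move: Fx Fy => /not_orP[/contrapT xW xnW] /not_orP[/contrapT yW ynW].
  by apply: xy; apply: sval_vertex_inj; exact: meet_in_addsm mxy xnW ynW.
rewrite -(card_le_eql (inj_card_eq c_inj)).
apply: subset_card_le => _ [x _ <-]; rewrite /c /=.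
by case: pselect => Fx //; exact: ltnW (em _ Fx).
Qed.

Hypothesis SS' : ~ meets S S'.

Lemma graph_lin (f : {linear submod_type S -> submod_type S'}) a (x y : M) :
  (exists u : submod_type S, val u + val (f u) = x) ->
  (exists u : submod_type S, val u + val (f u) = y) ->
  exists u : submod_type S, val u + val (f u) = a *: x + y.
Proof.
move=> [u <-] [v <-]; exists (a *: u + v).
by rewrite (linearP f) !val_lin scalerDr addrACA.
Qed.

Lemma graph0 (f : {linear submod_type S -> submod_type S'}) :
  exists u : submod_type S, val u + val (f u) = 0.
Proof. by exists 0; rewrite (raddf0 f) !val_zero addr0. Qed.

Definition graphsm f : submodClosed M := submod_of (graph0 f) (@graph_lin f).

Lemma sum_uniq (x x' : submod_type S) (y y' : submod_type S') :
  val x + val y = val x' + val y' -> x = x' /\ y = y'.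
Proof.
move=> E; have E' : val x - val x' = val y' - val y.
  by apply/eqP; rewrite subr_eq addrAC eq_sym subr_eq E addrC.
have /eqP : val x - val x' = 0.
  apply: (not_meets SS'); first by rewrite submodB //; exact: valP.
  by rewrite E' submodB //; exact: valP.
rewrite subr_eq0 => /eqP/val_inj xx'; split=> //; subst x'.
by apply/val_inj/(addrI (val x)).
Qed.

(** The graph contains [x + f x], which is nonzero for nonzero [x]; it omits every nonzero element
    of [S'], whose [S]-component is zero. *)
Lemma graphsm_nontrivial f : nontrivial_submodule (graphsm f).
Proof.
split.
  apply/set_neq0; case: sS.1 => x xS x0; pose u : submod_type S := Sub x xS.
  exists (val u + val (f u)); first by apply/in_submod_of; exists u.
  apply/eqP => u0; have [] := @sum_uniq u 0 (f u) 0.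
    by rewrite u0 !val_zero addr0.
  by move/(congr1 val) => /= xE; rewrite xE eqxx in x0.
move=> E; case: sS'.1 => y yS y0.
pose v : submod_type S' := Sub y yS.
have : [set` graphsm f] y by rewrite E.
move=> /in_submod_of[u uE].
have [u0 fy] : u = 0 /\ f u = v by apply: sum_uniq; rewrite uE val_zero add0r.
by move: y0; rewrite -[y]/(val v) -fy u0 (raddf0 f) val_zero eqxx.
Qed.

(** An endomorphism [d] of [S] gives the graph of [f \o d]; the graph determines [f \o d], and
    injectivity of [f] then recovers [d]. *)
Lemma infinite_graph_pair (f : {linear submod_type S -> submod_type S'}) :
  injective f -> infinite_set [set: endo (submod_type S)] ->
  infinite_graph (intersection_graph M).
Proof.
move=> f_inj infE finG; apply: infE.
pose G (d : endo (submod_type S)) : intersection_graph M :=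
  exist _ _ (graphsm_nontrivial
    (f \o d : {linear submod_type S -> submod_type S'})).
apply: (@finite_injective_image _ _ G); last exact: sub_finite_set finG.
move=> d d' _ _ /(congr1 sval) /= E; apply: endo_eqP => x.
have : val x + val (f (d x)) \in
    graphsm (f \o d : {linear submod_type S -> submod_type S'}).
  by apply/in_submod_of; exists x.
by rewrite E => /in_submod_of[u /sum_uniq[-> /f_inj]].
Qed.
End SumOfTwoSimples.

(** * Equivalence of the graph conditions with the conditions on the socle *)

Theorem theorem4p2 (R : pzRingType) (M : lmodType R) :
  (infinite_graph (intersection_graph M) /\
   finite_clique_number (intersection_graph M))
  <->
  ((exists S S' : submodClosed M,
      [/\ simple_submodule S /\ simple_submodule S',
          is_direct_sum (socle M) S S',
          isomorphic_modules (submod_type S) (submod_type S'),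
          division_ring (endo (submod_type S))
        & infinite_set [set: endo (submod_type S)]]) /\
   finite_set [set N : submodClosed M | ~ ([set` N] `<=` socle M)]).
Proof.
have addsmE (S S' : submodClosed M) :
    [set` addsm S S'] = [set x + y | x in [set` S] & y in [set` S']].
  apply/seteqP; split=> z.
    by move=> /addsmP[x [y [xS yS ->]]]; exists x => //; exists y.
  by move=> [x xS [y yS <-]]; apply/addsmP; exists x, y.
split=> [[infG [n [bn _]]]|[[S [S' [[sS sS'] [socE SS'] [f bf] _ infE]]] fin]].
  have finC (C : set (intersection_graph M)) (cC : clique C) : finite_set C.
    by apply/finite_set_leP; exists n; exact: bn.
  have [S [S' [sS sS' SS' infW]]] := infinite_simples_pair finC infG.
  have socW := socle_pair finC sS sS' infW.
  split; last first.
    apply: sub_finite_set (finite_outside_pair finC sS sS' infW) => N NW sub.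
    by apply: NW => x; rewrite socW => /sub.
  have ssS : simple_submodule S by exact/simple_submoduleP.
  exists S, S'; split; [| | |exact: schur|exact: infinite_endo_pair infW].
  - by split=> //; exact/simple_submoduleP.
  - split; first by rewrite socW addsmE.
    by apply: contrapT => /setI_neq0/(simple_eq sS sS').
  - have [f [g [fK gK]]] := isom_pair sS sS' SS' infW.
    by exists f; exists g.
move: sS sS' => /simple_submoduleP sS /simple_submoduleP sS'.
split.
  have nSS' : ~ meets S S' by move/setI_neq0; apply.
  by apply: (infinite_graph_pair sS sS' nSS') infE; exact: (bij_inj bf).
apply: (finite_clique_number_pair sS sS').
apply: sub_finite_set fin => N NW sub; apply: NW => x xN.
by have := sub x xN; rewrite socE -addsmE.
Qed.
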